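(* Every graph $G$ with pathwidth $k$ has convex crossing number $$\mathrm{cr}^{\star}(G)\leq k^2\cdot\Delta(G)\cdot|V(G)|.$$
   Context: All graphs are undirected, simple and finite. $\Delta(G)$ denotes the maximum degree of $G$. Pathwidth is the usual notion (one less than the minimum, over all path decompositions in which the endpoints of every edge lie in a common bag, of the maximum cardinality of a bag). A convex drawing of a graph represents the vertices by distinct points in the plane in convex position and each edge by the line-segment between its endpoints, such that the only vertices an edge intersects are its own endpoints, and no three edges intersect at a common point (except at a common endpoint). A crossing is a point of intersection between two edges other than a common endpoint. The convex crossing number $\mathrm{cr}^{\star}(G)$ is the minimum number of crossings in a convex drawing of $G$. *)

(* Defs.v *)
(* MathComp-Analysis; the plane is 'rV[R]_2 for an arbitrary R : realType. *)
From HB Require Import structures.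
From mathcomp Require Import all_boot all_order all_algebra.
From mathcomp Require Import interval_inference.
From mathcomp Require Import mathcomp_extra boolp classical_sets functions.
From mathcomp Require Import cardinality reals constructive_ereal ereal convex.

Set Implicit Arguments.
Unset Strict Implicit.
Unset Printing Implicit Defensive.

Import Order.TTheory GRing.Theory Num.Theory.

Local Open Scope ring_scope.
Local Open Scope convex_scope.

Record sgraph := SGraph {
  vertex :> finType;
  adj : rel vertex;
  adj_sym : symmetric adj;
  adj_irrefl : irreflexive adj
}.

Section Graph.
Variable G : sgraph.

Definition edges : {set {set G}} :=
  [set e : {set G} | [exists u, exists v, adj u v && (e == [set u; v])]]%SET.

Definition neighbors (v : G) : {set G} := [set u | adj v u]%SET.

Definition max_degree : nat := (\max_(v : G) #|neighbors v|)%N.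

(* The bags are listed in the order in which they occur along the path. *)
Record is_path_decomposition (B : seq {set G}) : Prop := IsPathDecomposition {
  pd_vertex : forall v : G, exists2 X, X \in B & v \in X;
  pd_edge : forall e, e \in edges -> exists2 X, X \in B & e \subset X;
  pd_interval : forall (v : G) (i j l : nat), (i <= j <= l)%N ->
    (l < size B)%N -> v \in nth finset.set0 B i -> v \in nth finset.set0 B l ->
    v \in nth finset.set0 B j
}.

Definition max_bag (B : seq {set G}) : nat := (\max_(X <- B) #|X|)%N.

Lemma ex_path_decomposition :
  exists m, `[< exists2 B, is_path_decomposition B & max_bag B = m >].
Proof.
exists (max_bag [:: finset.setT]); apply/asboolP; exists [:: finset.setT] => //.
split=> [v|e _|v i j [|l]] //=.
- by exists finset.setT; rewrite ?mem_head// finset.in_setT.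
- by exists finset.setT; rewrite ?mem_head// finset.subsetT.
- by rewrite leqn0 => /andP[_ /eqP->] _; rewrite finset.in_setT.
Qed.

(* Truncated predecessor: the graph without vertices gets pathwidth 0,
   not -1. *)
Definition pathwidth : nat := (ex_minn ex_path_decomposition).-1.

End Graph.

Section ConvexDrawing.
Local Open Scope classical_set_scope.
Local Open Scope card_scope.
Variable R : realType.

Definition plane : Type := convex_lmodType 'rV[R]_2.

Definition segment (a b : plane) : set plane :=
  [set a <| t |> b | t in [set: {i01 R}]].

Definition convex_hull (A : set plane) : set plane :=
  smallest (@convex_set R 'rV[R]_2) A.

Variable G : sgraph.
Implicit Types (f : G -> plane) (e : {set G}).

(* The union is over the (at most two) orderings (u, v) of the endpoints of e,
   which give the same segment. *)
Definition drawn_edge f e : set plane :=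
  [set p | exists u v : G, e = [set u; v]%SET /\ segment (f u) (f v) p].

Definition common_endpoint f (es : seq {set G}) (p : plane) : Prop :=
  exists v : G, (forall e, e \in es -> v \in e) /\ p = f v.

Definition convex_position f : Prop :=
  forall v : G, ~ convex_hull [set f u | u in [set u | u != v]] (f v).

Record is_convex_drawing f : Prop := IsConvexDrawing {
  cd_inj : injective f;
  cd_convex : convex_position f;
  cd_vertex : forall e (v : G), e \in edges G -> drawn_edge f e (f v) -> v \in e;
  cd_triple : forall e1 e2 e3 (p : plane),
    e1 \in edges G -> e2 \in edges G -> e3 \in edges G ->
    uniq [:: e1; e2; e3] ->
    drawn_edge f e1 p -> drawn_edge f e2 p -> drawn_edge f e3 p ->
    common_endpoint f [:: e1; e2; e3] p
}.

Definition crossings f : set plane :=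
  [set p | exists e1 e2, [/\ e1 \in edges G, e2 \in edges G & e1 != e2] /\
    [/\ drawn_edge f e1 p, drawn_edge f e2 p
      & ~ common_endpoint f [:: e1; e2] p]].

(* The infimum is taken over a set of natural numbers, so it is a minimum as
   soon as some convex drawing has finitely many crossings; without any such
   drawing it would be +oo. *)
Definition convex_crossing_number : \bar R :=
  ereal_inf [set n%:R%:E | n in
    [set n : nat | exists2 f, is_convex_drawing f & crossings f #= `I_n]].

End ConvexDrawing.

(* Main.v *)
(* Order the vertices by the first bag containing them (ties broken arbitrarily)
   and place them in this order on the parabola y = x^2. If a < b < c < d and the
   edges ac and bd cross, then a and b both lie in the first bag of c, so there
   are |V| choices for c, at most k for each of a and b, and at most Delta for d.
   No three chords are concurrent because the abscissae are integers, each at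
   least the fourth power of the previous one: if M is the largest abscissa of the
   end points of two crossing chords, then the abscissa of the crossing has
   denominator at most 2 M, so the crossing is too far to the right of any other
   integer to lie on a chord that ends beyond M^4. *)
Require Import Defs.
From mathcomp Require Import all_boot all_order all_algebra.
From mathcomp Require Import interval_inference boolp.
From mathcomp Require Import classical_sets cardinality.
From mathcomp Require Import reals constructive_ereal ereal convex.
From mathcomp Require Import ring lra zify.

Set Implicit Arguments.
Unset Strict Implicit.
Unset Printing Implicit Defensive.

Import Order.TTheory GRing.Theory Num.Theory.

Local Open Scope ring_scope.
Local Open Scope convex_scope.

(** * Chords of the parabola that meet over a common abscissa *)

Section Chords.
Variable R : realFieldType.
Implicit Types s t u v x w : R.

(** Over [x], the chord of y = x^2 with end abscissae [s] and [t] is [(x - s) * (t - x)] above the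
    parabola, so equal products mean that two chords meet over [x]. *)
Lemma chord_eq_right s t u x : s < x ->
  (x - s) * (t - x) = (x - s) * (u - x) -> t = u.
Proof.
move=> sx /mulfI e.
have /e : x - s != 0 by rewrite subr_eq0 gt_eqF.
by move/addIr.
Qed.

(** With [v <= t] the second product would be strictly smaller: nested chords do not meet. *)
Lemma chord_lt_right s t u v x : s < u -> u < x -> x < t ->
  (x - s) * (t - x) = (x - u) * (v - x) -> t < v.
Proof.
move=> su ux xt e; rewrite ltNge; apply/negP => vt.
have : (x - u) * (v - x) <= (x - u) * (t - x).
  by rewrite ler_wpM2l ?lerD2r// subr_ge0 ltW.
rewrite -e ler_pM2r ?subr_gt0// lerD2l lerN2 => us.
by move: su; rewrite ltNge us.
Qed.

(** The squares of [x] cancel, which leaves a linear equation. *)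
Lemma chord_isect s t u v x w : s + t < u + v ->
  (x - s) * (t - x) = w -> (x - u) * (v - x) = w ->
  x = (u * v - s * t) / (u + v - (s + t)).
Proof.
move=> lt e1 e2; apply: (canRL (mulfK _)); first by rewrite subr_eq0 gt_eqF.
by apply/eqP; rewrite -subr_eq0; apply/eqP; rewrite -(subrr w) -{1}e2 -e1; ring.
Qed.

End Chords.

Lemma chords_not_concurrent (R : realFieldType) (s1 t1 s2 t2 s3 t3 : nat)
    (x w : R) :
  (3 <= t2)%N -> (s1 < s2)%N -> (t1 < t2)%N -> (t2 ^ 4 <= t3)%N ->
  s1%:R < x < t1%:R -> s2%:R < x < t2%:R -> s3%:R < x < t3%:R ->
  (x - s1%:R) * (t1%:R - x) = w -> (x - s2%:R) * (t2%:R - x) = w ->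
  (x - s3%:R) * (t3%:R - x) = w -> False.
Proof.
move=> t2_ge3 s12 t12 t23 /andP[s1x xt1] /andP[s2x xt2] /andP[s3x xt3] e1 e2 e3.
pose d : R := s2%:R + t2%:R - (s1%:R + t1%:R).
have d0 : 0 < d by rewrite subr_gt0 ltrD// ltr_nat.
have dx : d * x = s2%:R * t2%:R - s1%:R * t1%:R.
  rewrite mulrC (@chord_isect _ s1%:R t1%:R s2%:R t2%:R x w)// ?divfK ?gt_eqF//.
  by rewrite -subr_gt0.
(* As [d] is a denominator of [x], this product is an integer; being positive, it is at least 1. *)
have z : d * (x - s3%:R) =
    ((s2%:Z * t2%:Z - s1%:Z * t1%:Z) - s3%:Z * (s2%:Z + t2%:Z - (s1%:Z + t1%:Z)))%:~R.
  by rewrite mulrBr dx !(rmorphB, rmorphD, rmorphM)/= -!pmulrn /d; ring.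
have d1 : 1 <= d * (x - s3%:R).
  have : 0 < d * (x - s3%:R) by rewrite mulr_gt0// subr_gt0.
  by rewrite z ltr0z ler1z gtz0_ge1.
have t1x_ge0 : 0 <= t3%:R - x by rewrite subr_ge0 ltW.
have h : t3%:R - x <= d * w.
  by rewrite -e3 mulrA -[leLHS]mul1r ler_wpM2r.
pose M : R := t2%:R.
have M3 : 3 <= M by rewrite ler_nat.
have s1_ge0 : 0 <= s1%:R :> R by [].
have t1_ge0 : 0 <= t1%:R :> R by [].
have s2_ge0 : 0 <= s2%:R :> R by [].
have t1M : t1%:R <= M by rewrite ler_nat ltnW.
have dM : d <= 2 * M.
  rewrite /d -/M; move: (lt_trans s2x xt2); rewrite -/M; lra.
have wM : w <= M * M.
  by rewrite -e1 ler_pM// ?subr_ge0 ?ltW//; rewrite -/M in xt2; lra.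
have w0 : 0 <= w by rewrite -e1 mulr_ge0// subr_ge0 ltW.
have t3M : M ^+ 4 <= t3%:R by rewrite -natrX ler_nat.
have dwM : d * w <= 2 * M * (M * M) by rewrite ler_pM// ltW.
(* Here [M ^+ 4 <= t3 <= x + d * w] and [x < M]. The resulting inequality holds at [M = 2] but fails
   from 3 on, whence [3 <= t2]. *)
have : M ^+ 4 <= M + 2 * M * (M * M).
  by rewrite -/M in xt2; lra.
have -> : M ^+ 4 = M * (M * (M * M)) by ring.
nra.
Qed.

(** * The drawing on the parabola and its crossings *)

Section ParabolaDrawing.
Variables (R : realType) (G : sgraph) (tau : G -> nat).
Hypothesis tau_ge3 : forall v, (3 <= tau v)%N.
Hypothesis tau_inj : injective tau.
Hypothesis tau_sparse : forall u v, (tau u < tau v)%N -> (tau u ^ 4 <= tau v)%N.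
Local Notation t v := ((tau v)%:R : R).

Definition parabola_point (v : G) : plane R := \row_(j < 2) (t v) ^+ j.+1.

(* A point p of the chord between the parabola points with abscissae s and t
   satisfies (p_x - s) (t - p_x) = excess p. *)
Definition excess (p : plane R) : R := p 0 1 - p 0 0 ^+ 2.

Lemma parabola_point0 v : parabola_point v 0 0 = t v.
Proof. by rewrite mxE expr1. Qed.

Lemma parabola_point1 v : parabola_point v 0 1 = t v ^+ 2.
Proof. by rewrite mxE. Qed.

Lemma excess_parabola_point v : excess (parabola_point v) = 0.
Proof. by rewrite /excess parabola_point0 parabola_point1 subrr. Qed.

Lemma parabola_pointP (p : plane R) v :
  p 0 0 = t v -> excess p = 0 -> p = parabola_point v.
Proof.
move=> p0 /subr0_eq p1; apply/rowP => j; rewrite mxE.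
case: j => [[|[|//]]] j2 /=.
  by rewrite expr1 -p0; congr (p _ _); apply: val_inj.
by rewrite -p0 -p1; congr (p _ _); apply: val_inj.
Qed.

Lemma conv_coord (a b : plane R) (l : {i01 R}) (j : 'I_2) :
  (a <| l |> b) 0 j = l%:num * a 0 j + (1 - l%:num) * b 0 j.
Proof. by rewrite !mxE. Qed.

Lemma parabola_point_inj : injective parabola_point.
Proof.
move=> u v uv; apply: tau_inj; apply/eqP.
by rewrite -(eqr_nat R) -!parabola_point0 uv.
Qed.

(* The tangent of the parabola at [parabola_point v] separates it from the
   other points. *)
Lemma parabola_convex_position : convex_position parabola_point.
Proof.
move=> v.
pose H : set (plane R) :=
  [set p | 0 < p 0 1 - 2 * t v * p 0 0 + t v ^+ 2]%classic.
have cH : convex_set H.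
  apply/convex_setW => p q /[!inE] Hp Hq l l0 l1.
  rewrite inE /H /= !conv_coord.
  move: Hp Hq; rewrite /H /= => Hp Hq.
  set m := l%:num in l0 l1 *.
  have -> : m * p 0 1 + (1 - m) * q 0 1
      - 2 * t v * (m * p 0 0 + (1 - m) * q 0 0) + t v ^+ 2
    = m * (p 0 1 - 2 * t v * p 0 0 + t v ^+ 2)
      + (1 - m) * (q 0 1 - 2 * t v * q 0 0 + t v ^+ 2) by ring.
  by rewrite addr_gt0// mulr_gt0// subr_gt0.
have sub : ([set parabola_point u | u in [set u | u != v]] `<=` H)%classic.
  move=> _ [u /= uv <-]; rewrite /H /= parabola_point0 parabola_point1.
  rewrite [X in 0 < X](_ : _ = (t u - t v) ^+ 2); last by ring.
  by rewrite exprn_even_gt0//= subr_eq0 eqr_nat (inj_eq tau_inj).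
move=> /(smallest_sub cH sub); rewrite /H /= parabola_point0 parabola_point1.
by rewrite [X in 0 < X](_ : _ = 0) ?ltxx//; ring.
Qed.

(** Orients the edge by [tau] and trades the parameter of the segment for an equation to which the
    lemmas on chords apply. *)
Variant is_chord (e : {set G}) (p : plane R) : Prop :=
  IsChord a c of adj a c & e = [set a; c]%SET & (tau a < tau c)%N
    & t a <= p 0 0 <= t c
    & (p 0 0 - t a) * (t c - p 0 0) = excess p.

Lemma drawn_edge_chord e p :
  e \in edges G -> drawn_edge parabola_point e p -> is_chord e p.
Proof.
rewrite inE => /existsP[u /existsP[v /andP[uv /eqP eE]]] [a [c [acE [l _ pE]]]].
(* [edges] and [drawn_edge] each supply a pair of endpoints; the pairs agree up to order, so
   adjacency transfers. *)
have {u v uv eE} ac : adj a c.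
  have ce : c \in [set u; v]%SET by rewrite -eE acE !inE eqxx orbT.
  have ae : a \in [set u; v]%SET by rewrite -eE acE !inE eqxx.
  have ve : v \in [set a; c]%SET by rewrite -acE eE !inE eqxx orbT.
  have ue : u \in [set a; c]%SET by rewrite -acE eE !inE eqxx.
  have uNv : u != v by apply: contraTneq uv => ->; rewrite adj_irrefl.
  move: ae ce ve ue; rewrite !inE.
  move=> /orP[/eqP->|/eqP->] /orP[/eqP->|/eqP->] //; rewrite ?orbb.
  - by rewrite eq_sym (negPf uNv).
  - by rewrite adj_sym.
  - by move=> _; rewrite (negPf uNv).
have aNc : tau a != tau c.
  by rewrite (inj_eq tau_inj); apply: contraTneq ac => ->; rewrite adj_irrefl.
have l0 : 0 <= l%:num by [].
have l1 : 0 <= 1 - l%:num by rewrite subr_ge0.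
have p0 : p 0 0 = l%:num * t a + (1 - l%:num) * t c.
  by rewrite -pE conv_coord !parabola_point0.
have p1 : p 0 1 = l%:num * t a ^+ 2 + (1 - l%:num) * t c ^+ 2.
  by rewrite -pE conv_coord !parabola_point1.
have pac : (p 0 0 - t a) * (t c - p 0 0) = excess p.
  by rewrite /excess p0 p1; ring.
have [ac_lt|] := boolP (tau a < tau c)%N.
  exists a c => //; rewrite p0.
  have : 0 <= t c - t a by rewrite subr_ge0 ler_nat ltnW.
  set m := l%:num in l0 l1 *; move=> h.
  have := mulr_ge0 l0 h; have := mulr_ge0 l1 h; lra.
rewrite -leqNgt leq_eqVlt eq_sym (negPf aNc) /= => ca_lt.
exists c a => //; first by rewrite adj_sym.
- by rewrite acE finset.setUC.
- rewrite p0.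
  have : 0 <= t a - t c by rewrite subr_ge0 ler_nat ltnW.
  set m := l%:num in l0 l1 *; move=> h.
  have := mulr_ge0 l0 h; have := mulr_ge0 l1 h; lra.
- by rewrite -pac; ring.
Qed.

Lemma chord_excess_ge0 e p : is_chord e p -> 0 <= excess p.
Proof. by case=> a c _ _ _ /andP[ap pc] <-; rewrite mulr_ge0// subr_ge0. Qed.

(** One factor of the product vanishes: a chord meets the parabola only at its ends. *)
Lemma chord_excess0 e p : is_chord e p -> excess p = 0 ->
  exists2 v, v \in e & p = parabola_point v.
Proof.
move=> [a c _ -> _ _ eac] p0; move: (eac); rewrite p0 => /eqP.
rewrite mulf_eq0 => /orP[] /eqP/subr0_eq pE.
- by exists a; [rewrite !inE eqxx | apply: parabola_pointP].
- by exists c; [rewrite !inE eqxx orbT | apply: parabola_pointP].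
Qed.

Lemma chord_parabola_point e v : is_chord e (parabola_point v) -> v \in e.
Proof.
move=> /chord_excess0 /(_ (excess_parabola_point v))[u ue].
by move=> /parabola_point_inj ->.
Qed.

Lemma chord_strict a c (p : plane R) : t a <= p 0 0 <= t c ->
  (p 0 0 - t a) * (t c - p 0 0) = excess p -> 0 < excess p ->
  t a < p 0 0 < t c.
Proof.
move=> /andP[ap pc] e p0; rewrite !lt_neqAle ap pc !andbT.
by apply/andP; split; apply: contraTneq p0 => h;
  rewrite -e h subrr ?mulr0 ?mul0r ltxx.
Qed.

Lemma parabola_edges_meet e1 e2 p : is_chord e1 p -> is_chord e2 p ->
  excess p = 0 -> common_endpoint parabola_point [:: e1; e2] p.
Proof.
move=> c1 c2 p0; have [v ve1 pv] := chord_excess0 c1 p0.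
exists v; split=> // e; rewrite !inE => /orP[] /eqP -> //.
by apply: chord_parabola_point; rewrite -pv.
Qed.

(** A shared point on the parabola is an endpoint of all three edges. Above the parabola the left
    ends are distinct, so the chords can be sorted and [chords_not_concurrent] applies. *)
Lemma parabola_triple e1 e2 e3 p : uniq [:: e1; e2; e3] ->
  is_chord e1 p -> is_chord e2 p -> is_chord e3 p ->
  common_endpoint parabola_point [:: e1; e2; e3] p.
Proof.
rewrite /= !inE negb_or => /and3P[/andP[n12 n13] n23 _] h1 h2 h3.
have := chord_excess_ge0 h1; rewrite le_eqVlt => /orP[/eqP/esym p0|p0].
  have [v ve1 pv] := chord_excess0 h1 p0.
  by exists v; split=> // e; rewrite !inE => /or3P[] /eqP -> //;
    apply: chord_parabola_point; rewrite -pv.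
exfalso; case: h1 h2 h3 => a1 c1 _ e1E _ r1 q1 [a2 c2 _ e2E _ r2 q2].
case=> a3 c3 _ e3E _ r3 q3; subst e1 e2 e3.
have {}r1 := chord_strict r1 q1 p0; have {}r2 := chord_strict r2 q2 p0.
have {}r3 := chord_strict r3 q3 p0.
(* Sorting the left ends also sorts the right ends; sparsity then gives the fourth-power gap between
   [d2] and [d3]. *)
have main b1 d1 b2 d2 b3 d3 : t b1 < p 0 0 < t d1 -> t b2 < p 0 0 < t d2 ->
    t b3 < p 0 0 < t d3 ->
    (p 0 0 - t b1) * (t d1 - p 0 0) = excess p ->
    (p 0 0 - t b2) * (t d2 - p 0 0) = excess p ->
    (p 0 0 - t b3) * (t d3 - p 0 0) = excess p ->
    (tau b1 < tau b2 < tau b3)%N -> False.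
  move=> s1 s2 s3 u1 u2 u3 /andP[b12 b23].
  have d12 : (tau d1 < tau d2)%N.
    rewrite -(ltr_nat R); apply: (@chord_lt_right _ (t b1) _ (t b2) _ (p 0 0)).
    - by rewrite ltr_nat.
    - by case/andP: s2.
    - by case/andP: s1.
    - by rewrite u1.
  have d23 : (tau d2 < tau d3)%N.
    rewrite -(ltr_nat R); apply: (@chord_lt_right _ (t b2) _ (t b3) _ (p 0 0)).
    - by rewrite ltr_nat.
    - by case/andP: s3.
    - by case/andP: s2.
    - by rewrite u2.
  exact: (chords_not_concurrent (tau_ge3 d2) b12 d12 (tau_sparse d23)
                                s1 s2 s3 u1 u2 u3).
have neq b1 d1 b2 d2 : [set b1; d1]%SET != [set b2; d2]%SET ->
    t b1 < p 0 0 < t d1 -> t b2 < p 0 0 < t d2 ->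
    (p 0 0 - t b1) * (t d1 - p 0 0) = excess p ->
    (p 0 0 - t b2) * (t d2 - p 0 0) = excess p -> tau b1 != tau b2.
  move=> n12' /andP[s1 _] s2 u1 u2; apply: contraNneq n12' => /tau_inj b12.
  move: u2; rewrite -b12 -u1 => /esym/(chord_eq_right s1)/eqP.
  by rewrite eqr_nat => /eqP/tau_inj ->.
move: (neq _ _ _ _ n12 r1 r2 q1 q2) (neq _ _ _ _ n13 r1 r3 q1 q3).
move: (neq _ _ _ _ n23 r2 r3 q2 q3).
(* Six orders of the left ends remain once [lia] has discarded the two cyclic combinations. *)
case: (ltngtP (tau a2) (tau a3)) => // h23 _;
case: (ltngtP (tau a1) (tau a2)) => // h12 _;
case: (ltngtP (tau a1) (tau a3)) => // h13 _;
  try by clear -h12 h13 h23; lia.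
- by apply: (main a1 c1 a2 c2 a3 c3) => //; rewrite h12.
- by apply: (main a2 c2 a1 c1 a3 c3) => //; rewrite h12.
- by apply: (main a2 c2 a3 c3 a1 c1) => //; rewrite h23.
- by apply: (main a1 c1 a3 c3 a2 c2) => //; rewrite h13.
- by apply: (main a3 c3 a1 c1 a2 c2) => //; rewrite h13.
- by apply: (main a3 c3 a2 c2 a1 c1) => //; rewrite h23.
Qed.

Lemma parabola_convex_drawing : is_convex_drawing parabola_point.
Proof.
split.
- exact: parabola_point_inj.
- exact: parabola_convex_position.
- by move=> e v eG /(drawn_edge_chord eG)/chord_parabola_point.
- move=> e1 e2 e3 p e1G e2G e3G u h1 h2 h3.
  by apply: parabola_triple => //; apply: drawn_edge_chord.
Qed.

(** The abscissa comes from [chord_isect]; the ordinate is read off the line y = (s + t) x - s t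
    through the parabola points over s and t. As a function of the quadruple, it lets quadruples
    bound the crossings. *)
Definition chord_meet (q : G * G * G * G) : plane R :=
  let: (c, a, b, d) := q in
  let x := (t b * t d - t a * t c) / (t b + t d - (t a + t c)) in
  \row_(j < 2) (if j == 0 then x else (t a + t c) * x - t a * t c).

Lemma chord_meetP (p : plane R) a b c d : (tau a < tau b)%N -> (tau c < tau d)%N ->
  (p 0 0 - t a) * (t c - p 0 0) = excess p ->
  (p 0 0 - t b) * (t d - p 0 0) = excess p ->
  p = chord_meet (c, a, b, d).
Proof.
move=> ab cd q1 q2.
have x : p 0 0 = (t b * t d - t a * t c) / (t b + t d - (t a + t c)).
  by apply: chord_isect q1 q2; rewrite ltrD// ltr_nat.
have y : p 0 1 = (t a + t c) * p 0 0 - t a * t c.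
  have -> : p 0 1 = excess p + p 0 0 ^+ 2 by rewrite subrK.
  by rewrite -q1; ring.
apply/rowP => j; rewrite mxE -x.
case: j => [[|[|//]]] j2; first by rewrite /= (_ : Ordinal _ = 0)//; apply/val_inj.
by rewrite /= (_ : Ordinal _ = 1) ?y//; apply/val_inj.
Qed.

Lemma parabola_crossing p : crossings parabola_point p ->
  exists a b c d, [/\ adj a c, adj b d,
    [&& (tau a < tau b)%N, (tau b < tau c)%N & (tau c < tau d)%N]
    & p = chord_meet (c, a, b, d)].
Proof.
move=> [e1 [e2 [[e1G e2G n12] [/(drawn_edge_chord e1G) h1]]]].
move=> /(drawn_edge_chord e2G) h2 Ncommon.
have p0 : 0 < excess p.
  rewrite lt_neqAle (chord_excess_ge0 h1) andbT; apply: contra_notN Ncommon.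
  by move=> /eqP/esym; exact: parabola_edges_meet.
case: h1 h2 n12 {e1G e2G Ncommon} => a c ac -> _ r1 q1 [b d bd -> _ r2 q2] n12.
have {r1}/andP[ap pc] := chord_strict r1 q1 p0.
have {r2}/andP[bp pd] := chord_strict r2 q2 p0.
have ltR u v : (t u < t v) = (tau u < tau v)%N by rewrite ltr_nat.
case: (ltngtP (tau a) (tau b)) => [ab|ba|/tau_inj ab].
(* The right ends are ordered like the left ones, and [b] precedes [c] because the abscissa of [p]
   lies strictly between theirs. *)
- have cd : (tau c < tau d)%N.
    rewrite -ltR; apply: (@chord_lt_right _ (t a) _ (t b) _ (p 0 0)) => //.
      by rewrite ltR.
    by rewrite q1.
  exists a, b, c, d; split=> //; last exact: chord_meetP.
  by rewrite ab cd -ltR (lt_trans bp pc).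
- have dc : (tau d < tau c)%N.
    rewrite -ltR; apply: (@chord_lt_right _ (t b) _ (t a) _ (p 0 0)) => //.
      by rewrite ltR.
    by rewrite q2.
  exists b, a, d, c; split=> //; last exact: chord_meetP.
  by rewrite ba dc -ltR (lt_trans ap pd).
- case/eqP: n12; move: q2; rewrite -ab -q1 => /esym/(chord_eq_right ap)/eqP.
  by rewrite eqr_nat => /eqP/tau_inj ->.
Qed.
End ParabolaDrawing.

(** A fourth power multiplies the exponent by 4. Starting at [4 ^ 1] keeps every term above 3. *)
Lemma sparse_sequence (i j : nat) : (i < j)%N ->
  ((2 ^ (4 ^ i.+1)) ^ 4 <= 2 ^ (4 ^ j.+1))%N.
Proof. by move=> ij; rewrite -expnM -expnSr leq_exp2l// leq_exp2l. Qed.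

Lemma pathwidth_decomposition (G : sgraph) :
  exists2 B : seq {set G}, is_path_decomposition B &
    forall X, X \in B -> (#|X|.-1 <= pathwidth G)%N.
Proof.
rewrite /pathwidth; case: ex_minnP => m /asboolP[B Bpd <-] _.
exists B => // X XB; rewrite -!subn1 leq_sub2r// /max_bag.
exact: (@leq_bigmax_seq _ B xpredT (fun X : {set G} => #|X|)).
Qed.

(** * The vertex order of a path decomposition and the count of quadruples *)

Section PathOrder.
Variables (G : sgraph) (B : seq {set G}).
Hypothesis Bpd : is_path_decomposition B.

Definition first_index (v : G) : nat := find (fun X : {set G} => v \in X) B.
Definition first_bag (v : G) : {set G} := nth finset.set0 B (first_index v).

Lemma first_index_lt v : (first_index v < size B)%N.
Proof.
rewrite -has_find; apply/hasP; have [X XB vX] := pd_vertex Bpd v.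
by exists X.
Qed.

Lemma mem_first_bag v : v \in first_bag v.
Proof.
by apply: (@nth_find _ finset.set0 (fun X : {set G} => v \in X));
  rewrite has_find first_index_lt.
Qed.

Lemma first_bag_mem v : first_bag v \in B.
Proof. exact/mem_nth/first_index_lt. Qed.

(** A bag containing both [u] and [v] comes no earlier than the first bag of [v], so the first bag
    of [w] lies between two bags containing [u]. *)
Lemma adj_first_bag u v w : adj u v -> (first_index u <= first_index w)%N ->
  (first_index w <= first_index v)%N -> u \in first_bag w.
Proof.
move=> uv uw wv.
have uvE : [set u; v]%SET \in edges G.
  by rewrite inE; apply/existsP; exists u; apply/existsP; exists v; rewrite uv /=.
have [X XB /fintype.subsetP uvX] := pd_edge Bpd uvE.
have uX : u \in X by apply: uvX; rewrite !inE eqxx.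
have vX : v \in X by apply: uvX; rewrite !inE eqxx orbT.
have iX : (index X B < size B)%N by rewrite index_mem.
have nX : nth finset.set0 B (index X B) = X by exact: nth_index.
apply: (@pd_interval _ _ Bpd u (first_index u) _ (index X B)) => //.
- rewrite uw (leq_trans wv)// leqNgt; apply/negP.
  by move=> /(before_find finset.set0); rewrite nX vX.
- exact: mem_first_bag.
- by rewrite nX.
Qed.

(** Lexicographic order in base [#|G|]: [enum_rank] breaks ties between vertices with the same first
    bag. *)
Definition path_key (v : G) : nat := (first_index v * #|G| + enum_rank v)%N.

Lemma path_key_lt u v : (path_key u < path_key v)%N ->
  (first_index u <= first_index v)%N.
Proof.
apply: contraTT; rewrite -ltnNge -leqNgt /path_key => vu.
have : ((first_index v).+1 * #|G| <= first_index u * #|G|)%N.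
  by rewrite leq_mul2r vu orbT.
move=> h; apply: leq_trans (leq_trans _ h) (leq_addr _ _).
by rewrite mulSn addnC leq_add2r ltnW.
Qed.

Lemma path_key_inj : injective path_key.
Proof.
move=> u v; rewrite /path_key => uv; apply/enum_rank_inj/val_inj.
have := congr1 (modn^~ #|G|) uv.
by rewrite !modnMDl !modn_small.
Qed.

(* The quadruples (c, a, b, d) that can occur in a crossing of ac and bd with
   a < b < c < d. *)
Definition crossing_quads : {set G * G * G * G} :=
  [set q : G * G * G * G | let: (c, a, b, d) := q in
    [&& a \in first_bag c :\ c, b \in first_bag c :\ c & d \in neighbors b]]%SET.

Lemma crossing_quadsP a b c d : adj a c -> adj b d ->
  (path_key a < path_key b)%N -> (path_key b < path_key c)%N ->
  (path_key c < path_key d)%N -> (c, a, b, d) \in crossing_quads.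
Proof.
move=> ac bd ab bc cd; have ne u v : (path_key u < path_key v)%N -> u != v.
  by apply: contraTneq => ->; rewrite ltnn.
rewrite !inE ne ?(ltn_trans ab)// ne//= bd andbT.
apply/andP; split.
(* Both edges, [ac] and [bd], reach from before [c] to [c] or beyond. *)
- by apply: (adj_first_bag ac) => //; apply/path_key_lt/(ltn_trans ab).
- by apply: (adj_first_bag bd); exact: path_key_lt.
Qed.

Lemma card_crossing_quads k : (forall X, X \in B -> (#|X|.-1 <= k)%N) ->
  (#|crossing_quads| <= k ^ 2 * max_degree G * #|G|)%N.
Proof.
move=> Bk.
(* Removing [c] from its own first bag turns the bound [k + 1] on bags into [k]. *)
have bag c : (#|(first_bag c :\ c)%SET| <= k)%N.
  have := Bk _ (first_bag_mem c).
  by rewrite (finset.cardsD1 c (first_bag c)) mem_first_bag.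
have -> : #|crossing_quads| = (\sum_c \sum_(a in first_bag c :\ c)
    \sum_(b in first_bag c :\ c) #|neighbors b|)%N.
  under [RHS]eq_bigr do under eq_bigr do under eq_bigr do rewrite -sum1_card.
  rewrite !pair_big_dep -sum1_card; apply: eq_bigl => -[[[c a] b] d].
  by rewrite inE /= !andbA.
have -> : (k ^ 2 * max_degree G * #|G| =
    \sum_(c : G) k * (k * max_degree G))%N.
  by rewrite sum_nat_const [RHS]mulnC mulnA mulnn.
apply: leq_sum => c _; apply: leq_trans (leq_mul (bag c) (leqnn _)).
rewrite -sum_nat_const; apply: leq_sum => a _.
apply: leq_trans (leq_mul (bag c) (leqnn _)).
rewrite -sum_nat_const; apply: leq_sum => b _.
by rewrite /max_degree (leq_bigmax b).
Qed.
End PathOrder.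

Theorem theorem18 (R : realType) (G : sgraph) (k : nat) :
  pathwidth G = k ->
  (convex_crossing_number R G <= (k ^ 2 * max_degree G * #|G|)%N%:R%:E)%E.
Proof.
move=> <-; have [B Bpd Bk] := pathwidth_decomposition G.
pose tau v := (2 ^ (4 ^ (path_key B v).+1))%N.
have tau_ge3 v : (3 <= tau v)%N.
  by apply: (@leq_trans (2 ^ (4 ^ 1))%N) => //; rewrite !leq_exp2l.
have tau_lt u v : (tau u < tau v)%N = (path_key B u < path_key B v)%N.
  by rewrite !ltn_exp2l.
have tau_inj : injective tau.
  move=> u v /eqP; rewrite !eqn_exp2l// eqSS => /eqP; exact: path_key_inj.
have tau_sparse u v : (tau u < tau v)%N -> (tau u ^ 4 <= tau v)%N.
  by rewrite tau_lt; exact: sparse_sequence.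
have drawing := parabola_convex_drawing R tau_ge3 tau_inj tau_sparse.
pose quads := crossing_quads B.
(* Indexing by naturals makes the crossings part of an image of an initial segment; the default 0 is
   not reached for indices below [#|quads|]. *)
pose meets i : plane R := nth 0 [seq chord_meet R tau q | q <- enum quads] i.
have sub : (crossings (parabola_point R tau) `<=`
    [set meets i | i in `I_#|quads|])%classic.
  move=> p /(parabola_crossing tau_inj)[a [b [c [d [ac bd /and3P[ab bc cd] ->]]]]].
  have q : (c, a, b, d) \in enum quads.
    by rewrite mem_enum; apply: crossing_quadsP => //; rewrite -tau_lt.
  exists (index (c, a, b, d) (enum quads)); first by rewrite /= cardE index_mem.
  by rewrite /meets (nth_map (c, a, b, d)) ?index_mem// nth_index.
have fin : finite_set (crossings (parabola_point R tau)).
  by apply: sub_finite_set sub _; exact/finite_image/finite_II.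
have [n crn] := (finite_setP _).1 fin.
have n_le : (n <= #|quads|)%N.
  rewrite -card_le_II -(card_le_eql crn).
  exact: card_le_trans (subset_card_le sub) (card_image_le _ _).
apply: (@le_trans _ _ n%:R%:E).
  by apply: ereal_inf_lbound; exists n => //; exists (parabola_point R tau).
by rewrite lee_fin ler_nat (leq_trans n_le)// card_crossing_quads.
Qed.
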